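(* Relative to the commutative ai-semiring axioms, complete bases of identities of $R_{01},R_{02},R_{11},R_{12}$ are the following: $$\begin{array}{c|c} R_{01}&\Sigma_0\cup\{\xi,\alpha,\beta\}\\ R_{02}&\Sigma_0\cup\{\xi,\eta\}\\ R_{11}&\Sigma_0\cup\{\alpha\}\\ R_{12}&\Sigma_0\cup\{\theta_n:n\ge1\}. \end{array}$$ That is, for each of these semirings, the listed identities together with the commutative ai-semiring axioms hold in the semiring and imply all of its identities.
   Context: A commutative ai-semiring is an algebra $(S,+,\cdot)$ (language of two binary operations, no constants) in which both operations are associative and commutative, $x+x\approx x$, and multiplication distributes over addition. For terms $u,v$, $u\preceq v$ abbreviates the identity $u+v\approx v$. Let $M=\{0,c,p,q,a,b\}$ be the commutative semigroup whose only nonzero products are $pb=bp=ab=ba=aq=qa=c$ (every other product, including every square, is $0$). For $i,j\in\{0,1,2\}$, $R_{ij}$ is the commutative ai-semiring on $M$ with this multiplication whose addition is the join operation of the partial order on $M$ generated by $a<p<0$, $b<q<0$, $c<0$, together with: the first $i$ elements of the chain $a<p$ lie below $c$, and the first $j$ elements of the chain $b<q$ lie below $c$. $\Sigma_0$ consists of the identities $x\preceq y^2$, $x^2\approx yzt$, and, for every $n\ge1$, $$\sigma_n:\quad x\preceq x_1x_2+x_2x_3+\cdots+x_{2n}x_{2n+1}+x_{2n+1}x_1.$$ Further identities (with distinct variables): - $\xi:\ x^2\approx x+y+xy$; - $\alpha:\ x_1x_4\preceq x_1+x_1x_2+x_2x_3+x_3x_4$; - $\beta:\ xz\preceq x+xy+t+tz$;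 - $\eta:\ z\preceq x+xy+yz$; - $\theta_n:\ x_1x_{2n+2}\preceq x_1+x_{2n+2}+x_1x_2+x_2x_3+\cdots+x_{2n+1}x_{2n+2}$. *)

(* Defs.v *)
From HB Require Import structures.
From mathcomp Require Import all_boot.
From mathcomp Require Import classical_sets.

Set Implicit Arguments.
Unset Strict Implicit.
Unset Printing Implicit Defensive.

Record caiSemiring : Type := CaiSemiring {
  car :> Type;
  sadd : car -> car -> car;
  smul : car -> car -> car;
  saddA : associative sadd;
  saddC : commutative sadd;
  saddxx : idempotent_op sadd;
  smulA : associative smul;
  smulC : commutative smul;
  smulDl : left_distributive smul sadd
}.

Inductive term : Type :=
  | Var of nat
  | Add of term & term
  | Mul of term & term.

Declare Scope term_scope.
Delimit Scope term_scope with trm.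
Bind Scope term_scope with term.
Notation "u + v" := (Add u v) : term_scope.
Notation "u * v" := (Mul u v) : term_scope.
Notation "''x_' k" := (Var k) (at level 8, k at level 2, format "''x_' k").

Definition identity : Type := (term * term)%type.

Notation "u ≈ v" := ((u%trm, v%trm) : identity)
  (at level 70, no associativity).
Notation "u ⪯ v" := ((Add u%trm v%trm, v%trm) : identity)
  (at level 70, no associativity).

Fixpoint eval (S : caiSemiring) (f : nat -> S) (t : term) : S :=
  match t with
  | Var k => f k
  | Add u v => sadd (eval f u) (eval f v)
  | Mul u v => smul (eval f u) (eval f v)
  end.

Definition satisfies (S : caiSemiring) (e : identity) : Prop :=
  forall f : nat -> S, eval f e.1 = eval f e.2.

Definition models (S : caiSemiring) (Sigma : set identity) : Prop :=
  forall e, Sigma e -> satisfies S e.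

(* Semantic consequence relative to the commutative ai-semiring axioms: S     *)
(* ranges over the commutative ai-semirings only.                             *)
Definition entails (Sigma : set identity) (e : identity) : Prop :=
  forall S : caiSemiring, models S Sigma -> satisfies S e.

Definition is_basis (S : caiSemiring) (Sigma : set identity) : Prop :=
  models S Sigma /\ (forall e, satisfies S e -> entails Sigma e).

Inductive M : Type := M0 | Mc | Mp | Mq | Ma | Mb.

Definition M_code (x : M) : 'I_6 :=
  match x with
  | M0 => @Ordinal 6 0 isT | Mc => @Ordinal 6 1 isT | Mp => @Ordinal 6 2 isT
  | Mq => @Ordinal 6 3 isT | Ma => @Ordinal 6 4 isT | Mb => @Ordinal 6 5 isT
  end.

Definition M_decode (k : 'I_6) : M := nth M0 [:: M0; Mc; Mp; Mq; Ma; Mb] k.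

Fact M_codeK : cancel M_code M_decode.
Proof. by case. Qed.

HB.instance Definition _ := Countable.copy M (can_type M_codeK).
HB.instance Definition _ : isFinite M := CanIsFinite M_codeK.

Definition Mmul (x y : M) : M :=
  match x, y with
  | Mp, Mb | Mb, Mp | Ma, Mb | Mb, Ma | Ma, Mq | Mq, Ma => Mc
  | _, _ => M0
  end.

Section Semirings.

Variables i j : nat.

(* The relations generating the order. Only i, j <= 2 are meaningful; larger  *)
(* values behave as 2.                                                        *)
Definition gen (x y : M) : bool :=
  match x, y with
  | Ma, Mp | Mp, M0 | Mb, Mq | Mq, M0 | Mc, M0 => true
  | Ma, Mc => 0 < i
  | Mp, Mc => 1 < i
  | Mb, Mc => 0 < j
  | Mq, Mc => 1 < j
  | _, _ => false
  end.

Definition Mle : rel M := connect gen.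

Definition is_join (x y z : M) : bool :=
  [&& Mle x z, Mle y z & [forall w, Mle x w && Mle y w ==> Mle z w]].

(* The default is never used, see Madd_join. *)
Definition Madd (x y : M) : M := odflt M0 [pick z | is_join x y z].

Lemma MleE x y : Mle x y = [|| x == y, y == M0 | gen x y].
Proof.
apply/idP/idP.
  case/connectP => s; elim: s x => [x _ ->|z s IHs x /= /andP[gxz gs] ey].
    by rewrite eqxx.
  case/or3P: (IHs z gs ey) => [/eqP ezy|/eqP ey0|gzy].
  - by rewrite -ezy gxz !orbT.
  - by rewrite ey0 eqxx orbT.
  - case: x z y gxz gzy {IHs gs ey} => [] [] [] //=;
      by move=> _ /ltnW.
case/or3P => [/eqP ->|/eqP ->|]; rewrite /Mle ?connect0 //; last exact: connect1.
case: x; rewrite ?connect0 //; try exact: connect1.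
  by apply: (@connect_trans _ _ Mp); apply: connect1.
by apply: (@connect_trans _ _ Mq); apply: connect1.
Qed.

Lemma Mle_refl : reflexive Mle.
Proof. by move=> x; apply: connect0. Qed.

Lemma Mle_trans : transitive Mle.
Proof. by move=> x y z; apply: connect_trans. Qed.

Lemma Mle_anti : antisymmetric Mle.
Proof.
by move=> x y; rewrite !MleE; case: x; case: y => //=; rewrite ?andbF.
Qed.

Let join (x y : M) : M :=
  if Mle x y then y else if Mle y x then x
  else if Mle x Mc && Mle y Mc then Mc else M0.

Let M_all (P : pred M) :
  [forall w, P w] = [&& P M0, P Mc, P Mp, P Mq, P Ma & P Mb].
Proof.
apply/forallP/idP => [Pw|]; first by rewrite !Pw.
by case/and5P => ? ? ? ? /andP[? ?] [].
Qed.

Let joinP x y : is_join x y (join x y).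
Proof.
rewrite /is_join M_all /join !MleE.
move: (@ltnW 1 i) (@ltnW 1 j).
case: x; case: y => //=; case: (0 < i); case: (1 < i);
  case: (0 < j); case: (1 < j) => //= ? ?; exfalso; auto.
Qed.

Let join_uniq x y z z' : is_join x y z -> is_join x y z' -> z = z'.
Proof.
move=> /and3P[xz yz /forallP lz] /and3P[xz' yz' /forallP lz'].
apply: Mle_anti; apply/andP; split.
  by apply: (implyP (lz z')); apply/andP.
by apply: (implyP (lz' z)); apply/andP.
Qed.

Lemma Madd_join x y : is_join x y (Madd x y).
Proof.
by rewrite /Madd; case: pickP => // /(_ (join x y)); rewrite joinP.
Qed.

Let MaddE x y : Madd x y = join x y.
Proof. exact: join_uniq (Madd_join x y) (joinP x y). Qed.

Fact MaddC : commutative Madd.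
Proof.
move=> x y; apply: (join_uniq (Madd_join x y)).
have /and3P[yz xz /forallP l] := Madd_join y x.
by apply/and3P; split=> //; apply/forallP => w; rewrite andbC.
Qed.

Fact Maddxx : idempotent_op Madd.
Proof. by move=> x; rewrite MaddE /join Mle_refl. Qed.

Let Madd_le x y w : Mle (Madd x y) w = Mle x w && Mle y w.
Proof.
have /and3P[xz yz /forallP l] := Madd_join x y.
apply/idP/idP; last exact: (implyP (l w)).
by move=> zw; rewrite (Mle_trans xz zw) (Mle_trans yz zw).
Qed.

Fact MaddA : associative Madd.
Proof.
move=> x y z; apply: Mle_anti.
have h w : Mle (Madd x (Madd y z)) w = Mle (Madd (Madd x y) z) w.
  by rewrite !Madd_le andbA.
by rewrite h Mle_refl -h Mle_refl.
Qed.

Fact MmulA : associative Mmul.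
Proof. by case; case; case. Qed.

Fact MmulC : commutative Mmul.
Proof. by case; case. Qed.

Fact MmulDl : left_distributive Mmul Madd.
Proof.
move=> x y z; rewrite !MaddE /join !MleE.
case: x; case: y => //=; rewrite ?eqxx ?orbT //=;
  case: (0 < i); case: (1 < i); case: (0 < j); case: (1 < j) => //=;
  by case: z.
Qed.

Definition R : caiSemiring :=
  CaiSemiring MaddA MaddC Maddxx MmulA MmulC MmulDl.

End Semirings.

Definition tsum (t : term) (s : seq term) : term := foldl Add t s.

Definition sigma (n : nat) : identity :=
  'x_0 ⪯ tsum ('x_1 * 'x_2)
             (rcons [seq Mul 'x_k 'x_k.+1 | k <- index_iota 2 (2 * n).+1]
                    ('x_(2 * n).+1 * 'x_1)%trm).

Definition Sigma0 : set identity :=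
  ([set 'x_0 ⪯ 'x_1 * 'x_1; 'x_0 * 'x_0 ≈ 'x_1 * 'x_2 * 'x_3] `|`
   [set sigma n | n in [set n | (1 <= n)%N]])%classic.

Definition xi : identity := 'x_0 * 'x_0 ≈ 'x_0 + 'x_1 + 'x_0 * 'x_1.

Definition alpha : identity :=
  'x_1 * 'x_4 ⪯ 'x_1 + 'x_1 * 'x_2 + 'x_2 * 'x_3 + 'x_3 * 'x_4.

(* x = 'x_0, y = 'x_1, z = 'x_2, t = 'x_3 *)
Definition beta : identity := 'x_0 * 'x_2 ⪯ 'x_0 + 'x_0 * 'x_1 + 'x_3 + 'x_3 * 'x_2.

Definition eta : identity := 'x_2 ⪯ 'x_0 + 'x_0 * 'x_1 + 'x_1 * 'x_2.

Definition theta (n : nat) : identity :=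
  'x_1 * 'x_(2 * n).+2 ⪯
    tsum ('x_1) ('x_(2 * n).+2 ::
                [seq Mul 'x_k 'x_k.+1 | k <- index_iota 1 (2 * n).+2]).

(* Main.v *)
(** Soundness: every product of [R i j] is [c] or [0], and [xy = c] forces [x]
    and [y] to lie on different sides of the bipartition {a, p}, {b, q}.

    Completeness: let [S] be a model, [g] an assignment in it, and [s] the value
    of the right-hand side, not the top of [S]. By Sigma0 the variables marked
    when [g x <= s], with an edge [xy] when [g x * g y <= s], form a bipartite
    graph. A 2-colouring of it by {a, p} and {b, q}, in which [p] and [q] are
    placed on an independent set, gives edges the value [c]; marked vertices
    must stay below [c], which is where [i] and [j] enter. If a word is not
    below [s], the closure of marks and edges under the remaining identities
    leaves enough freedom to choose the colouring and the independent set so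
    that the word is not below [c], although the right-hand side is. *)
Require Import Defs.
From mathcomp Require Import all_boot.
From mathcomp Require Import boolp classical_sets.

Set Implicit Arguments.
Unset Strict Implicit.
Unset Printing Implicit Defensive.

(** * The natural order, and terms as sums of words *)

Definition sle (S : caiSemiring) (x y : S) : Prop := sadd x y = y.

Section NaturalOrder.

Variable S : caiSemiring.
Implicit Types x y z : S.

Lemma sle_refl x : sle x x.
Proof. exact: saddxx. Qed.

Lemma sle_anti x y : sle x y -> sle y x -> x = y.
Proof. by rewrite /sle => xy yx; rewrite -yx saddC. Qed.

Lemma sle_trans x y z : sle x y -> sle y z -> sle x z.
Proof. by rewrite /sle => xy yz; rewrite -yz saddA xy. Qed.

Lemma sle_add x y z : sle (sadd x y) z <-> sle x z /\ sle y z.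
Proof.
rewrite /sle; split=> [xyz|[xz yz]]; last by rewrite -saddA yz xz.
split; rewrite -xyz; first by rewrite saddA saddA saddxx.
by rewrite (saddC x) saddA saddA saddxx.
Qed.

Lemma smulDr : right_distributive (@smul S) (@sadd S).
Proof. by move=> x y z; rewrite smulC smulDl !(smulC x). Qed.

End NaturalOrder.

(** The words of [t] are the monomials left after distributing all products over sums; they keep the
    bracketing of [t]. *)
Fixpoint word_of (t w : term) : Prop :=
  match t with
  | Var k => w = Var k
  | Add u v => word_of u w \/ word_of v w
  | Mul u v => exists a b, [/\ w = Mul a b, word_of u a & word_of v b]
  end.

(** The additive context [k] makes the induction pass through products: one factor is expanded while
    multiplication by the other is absorbed into the context. *)
Lemma sle_words_under (S : caiSemiring) (f : nat -> S) t (k : S -> S) s :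
    {morph k : x y / sadd x y} ->
  sle (k (eval f t)) s <-> forall w, word_of t w -> sle (k (eval f w)) s.
Proof.
elim: t k => [n|u IHu v IHv|u IHu v IHv] k kD /=.
- by split=> [ks w ->|h] //; exact: (h (Var n)).
- rewrite kD sle_add IHu // IHv //.
  split=> [[us vs] w []|h]; [exact: us|exact: vs|].
  by split=> w ?; apply: h; auto.
- rewrite (IHu (fun x => k (smul x (eval f v)))); last first.
    by move=> x y; rewrite smulDl kD.
  split=> [h w [a [b [-> ua vb]]]|h a ua] /=.
    have kD' : {morph (fun y => k (smul (eval f a) y)) : x y / sadd x y}.
      by move=> x y; rewrite smulDr kD.
    by move/(IHv _ kD'): (h _ ua); apply.
  rewrite (IHv (fun y => k (smul (eval f a) y))).
    by move=> b vb; apply: (h (Mul a b)); exists a, b.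
  by move=> x y; rewrite smulDr kD.
Qed.

Lemma sle_words (S : caiSemiring) (f : nat -> S) t s :
  sle (eval f t) s <-> forall w, word_of t w -> sle (eval f w) s.
Proof. exact: (@sle_words_under S f t id). Qed.

Lemma word_of_not_Add t u v : ~ word_of t (Add u v).
Proof. by elim: t => [//|t1 IH1 t2 IH2 []//|t1 _ t2 _ /= [a [b []]]]. Qed.

(** Words of three or more letters are described only through their values, since rebracketing them
    as a triple product changes the term. *)
Variant word_spec (w : term) : Prop :=
  | WordVar x of w = Var x
  | WordEdge x y of w = Mul (Var x) (Var y)
  | WordLong a b c of
      (forall (S : caiSemiring) (f : nat -> S),
         eval f w = smul (smul (eval f a) (eval f b)) (eval f c)).

Lemma wordP t w : word_of t w -> word_spec w.
Proof.
elim: t w => [n w ->|u IHu v IHv w []|u _ v _ w]; first exact: WordVar.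
- exact: IHu.
- exact: IHv.
case=> -[x|a1 a2|a1 a2] [b [-> ua vb]].
- case: b vb => [y _|b1 b2 /word_of_not_Add//|b1 b2 _]; first exact: WordEdge.
  by apply: (@WordLong _ (Var x) b1 b2) => S f /=; rewrite smulA.
- by case: (word_of_not_Add ua).
- exact: (@WordLong _ a1 a2 b).
Qed.

Lemma sle_of_sat (S : caiSemiring) u v (f : nat -> S) s :
  satisfies S (Add u v, v) -> sle (eval f v) s -> sle (eval f u) s.
Proof. by move=> /(_ f); apply: sle_trans. Qed.

Lemma sle_tsum (S : caiSemiring) (f : nat -> S) t (F : nat -> term) r s :
  sle (eval f (tsum t [seq F k | k <- r])) s <->
  sle (eval f t) s /\ forall k, k \in r -> sle (eval f (F k)) s.
Proof.
elim: r t => [|n r IHr] t /=; first by split=> [|[]].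
rewrite IHr /= sle_add; split=> [[[ts ns] rs]|[ts rs]].
  by split=> // k; rewrite inE => /orP[/eqP->|/rs].
split; first by split=> //; apply: rs; rewrite mem_head.
by move=> k kr; apply: rs; rewrite inE kr orbT.
Qed.

Lemma tsum_cons t u r : tsum t (u :: r) = tsum (Add t u) r.
Proof. by []. Qed.

Lemma tsum_rcons t r u : tsum t (rcons r u) = Add (tsum t r) u.
Proof. exact: foldl_rcons. Qed.

(** * Soundness *)

Section Soundness.

Variables i j : nat.
Implicit Types (x y z : R i j) (f : nat -> R i j).

Lemma sle_Mle x y : sle x y <-> Mle i j x y.
Proof.
have /and3P[xz yz /forallP lz] := Madd_join i j x y; split=> [<- //|xy].
apply: (@Mle_anti i j); apply/andP; split=> //.
by apply: (implyP (lz y)); rewrite xy Mle_refl.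
Qed.

Lemma sle_M0 x : sle x (M0 : R i j).
Proof. by rewrite sle_Mle MleE eqxx orbT. Qed.

(** Testing against every upper bound [s] splits a sum on the right into separate inequalities, one
    per summand. *)
Lemma sat_le u v :
    (forall f s, sle (eval f v) s -> sle (eval f u) s) ->
  satisfies (R i j) (Add u v, v).
Proof. by move=> uv f; apply: uv; apply: sle_refl. Qed.

(** Products take only the values [M0] and [Mc], and only [M0] lies strictly above [Mc]. The case
    [z = M0] is trivial wherever this is used. *)
Lemma sle_Mmul x y z : sle (smul x y) z -> z = M0 \/ z = Mc /\ Mmul x y = Mc.
Proof.
have [|] : Mmul x y = M0 \/ Mmul x y = Mc by case: x; case: y; auto.
all: by rewrite /= => xyE; rewrite sle_Mle /= xyE MleE; case: z; auto.
Qed.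

Definition side (x : M) : bool := (x == Mb) || (x == Mq).

Lemma side_Mmul (x y : M) : Mmul x y = Mc -> side y = ~~ side x.
Proof. by case: x; case: y. Qed.

Lemma side_walk (f : nat -> M) n :
    (forall k, 0 < k <= n -> Mmul (f k) (f k.+1) = Mc) ->
  side (f n.+1) = side (f 1) (+) odd n.
Proof.
elim: n => [|n IHn] fE; first by rewrite addbF.
rewrite (side_Mmul (fE n.+1 _)) ?leqnn // IHn ?addbN // => k /andP[k0 kn].
by rewrite fE // k0 ltnW.
Qed.

Lemma sat_sigma n : 0 < n -> satisfies (R i j) (sigma n).
Proof.
move=> n0; apply: sat_le => f s; rewrite tsum_rcons [eval f (Add _ _)]/=.
rewrite sle_add sle_tsum => -[[/= /sle_Mmul[->|[-> f12]]]]; first by move=> *;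
  apply: sle_M0.
move=> fE /sle_Mmul[//|[_ /side_Mmul]].
(* The [2 * n] edges from ['x_1] to ['x_(2n+1)] return to the same side, but the closing edge
   demands opposite sides. *)
rewrite (@side_walk f (2 * n)) ?oddM ?addbF => [|[|[|k]] // kn];
  first by case: (side _).
by case: (sle_Mmul (fE k.+2 _)) => [|//|[]]; rewrite ?mem_index_iota.
Qed.

Lemma sound_Sigma0 : models (R i j) Sigma0.
Proof.
move=> e [[->|->]|[n n0 <-]]; last exact: sat_sigma.
  apply: sat_le => f s; apply: sle_trans; rewrite /=.
  have -> : Mmul (f 1) (f 1) = M0 by case: (f 1).
  exact: sle_M0.
by move=> f /=; case: (f 0); case: (f 1) => //=; case: (f 2); case: (f 3).
Qed.

End Soundness.

Lemma sat_sle_anti i j u v :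
    (forall (f : nat -> R i j) s, sle (eval f u) s <-> sle (eval f v) s) ->
  satisfies (R i j) (u, v).
Proof. by move=> uv f; apply: sle_anti; apply/uv; apply: sle_refl. Qed.

(** Both sides equal [M0]: if [xy] is [Mc], one factor is [Ma] or [Mp], which is not below [Mc] when
    [i = 0]. *)
Lemma sat_xi j : satisfies (R 0 j.+1) xi.
Proof.
apply: sat_sle_anti => f s; rewrite /= !sle_add !sle_Mle /= !MleE.
by case: (f 0); case: (f 1); case: s => //=; intuition.
Qed.

(** Across the two sides only [Mp] and [Mq] multiply to [M0]. For [i, j < 2] neither lies below
    [Mc], so ['x_1] is [Ma] or [Mb], and ['x_4] is on the other side. *)
Lemma sat_alpha i j : i < 2 -> j < 2 -> satisfies (R i j) alpha.
Proof.
move=> i2 j2; apply: sat_le => f s; rewrite /= !sle_add.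
case=> -[[f1 /sle_Mmul[->|[sE f12]]]]; first by move=> *; apply: sle_M0.
move: f1; rewrite {}sE => f1 /sle_Mmul[//|[_ f23]] /sle_Mmul[//|[_ f34]].
move: f12 f23 f34 f1; rewrite !sle_Mle !MleE.
by case: (f 1); case: (f 2) => //= _; case: (f 3) => //= _;
  case: (f 4) => //= _;
  move: i2 j2; case: ltnP => // _; case: ltnP.
Qed.

Lemma sat_beta : satisfies (R 0 1) beta.
Proof.
apply: sat_le => f s; rewrite /= !sle_add.
case=> -[[f0 /sle_Mmul[->|[sE f01]]]]; first by move=> *; apply: sle_M0.
rewrite sE in f0 * => f3 /sle_Mmul[//|[_ f32]].
move: f01 f32 f0 f3; rewrite !sle_Mle !MleE.
by case: (f 0); case: (f 1) => //= _; case: (f 2); case: (f 3).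
Qed.

(** Here ['x_0] lies in {b, q}, hence so does ['x_2], and this whole side is below [Mc]. *)
Lemma sat_eta j : satisfies (R 0 j.+2) eta.
Proof.
apply: sat_le => f s; rewrite /= !sle_add.
case=> -[f0 /sle_Mmul[->|[sE f01]]]; first by move=> *; apply: sle_M0.
rewrite sE in f0 * => /sle_Mmul[//|[_ f12]].
move: f01 f12 f0; rewrite !sle_Mle !MleE.
by case: (f 0); case: (f 1) => //= _; case: (f 2).
Qed.

(** The ends lie on opposite sides. The one in {a, p} is below [Mc], so it is [Ma], whose product
    with [Mb] or [Mq] is [Mc]. *)
Lemma sat_theta j n : satisfies (R 1 j) (theta n).
Proof.
apply: sat_le => f s.
rewrite tsum_cons sle_tsum [eval f (Add _ _)]/= sle_add => -[[f1 fl] fE].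
have /sle_Mmul[->|[sE f12]] := fE 1 (mem_head _ _); first exact: sle_M0.
rewrite {}sE in f1 fl fE *.
have fc k : 0 < k <= (2 * n).+1 -> Mmul (f k) (f k.+1) = Mc.
  by move=> kn; have [|//|[]] := sle_Mmul (fE k _); rewrite ?mem_index_iota.
have flast : Mmul (f (2 * n).+1) (f (2 * n).+2) = Mc by rewrite fc ?leqnn.
have := side_walk fc; move: f12 flast f1 fl.
rewrite oddS oddM addbT !sle_Mle !MleE /=.
by case: (f 1); case: (f 2) => //= _; case: (f _.+2); case: (f _.+1).
Qed.

(** * Two-colourings *)

Section Graph.

Variable E : rel nat.
Hypothesis E_sym : symmetric E.

(** Here [k] is the parity of the walk, [true] for odd length; [no_odd] below thus expresses
    bipartiteness. *)
Definition conn (k : bool) (x y : nat) : Prop :=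
  exists p, [/\ path E x p, last x p = y & odd (size p) = k].

Lemma conn_refl x : conn false x x.
Proof. by exists [::]. Qed.

Lemma conn_edge x y : E x y -> conn true x y.
Proof. by move=> xy; exists [:: y]; rewrite /= xy. Qed.

Lemma conn_trans k l x y z : conn k x y -> conn l y z -> conn (k (+) l) x z.
Proof.
move=> [p [xp <- <-]] [q [yq <- <-]]; exists (p ++ q).
by rewrite cat_path xp yq last_cat size_cat oddD.
Qed.

Lemma conn_sym k x y : conn k x y -> conn k y x.
Proof.
move=> [p [xp <- <-]]; elim: p x xp => [|z p IHp] x /=.
  by move=> _; apply: conn_refl.
move=> /andP[xz /IHp zp]; rewrite -addbT; apply: conn_trans zp _.
by apply: conn_edge; rewrite E_sym.
Qed.

Lemma conn_true_split x y : conn true x y -> exists2 z, E x z & conn false z y.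
Proof.
move=> [[|z p] [//= /andP[xz zp] zy podd]]; exists z => //; exists p;
  split=> //.
by apply: negbTE.
Qed.

Hypothesis no_odd : forall x, ~ conn true x x.

Lemma irr_E x : ~~ E x x.
Proof. by apply/negP => /conn_edge/no_odd. Qed.

Definition proper (h : pred nat) : Prop := forall x y, E x y -> h x (+) h y.

(* Once the least vertex of every component missing B is added to B, the *)
(* colour of a vertex is the parity of its walks to B. *)
Lemma ex_coloring (B : pred nat) :
    (forall x y, B x -> B y -> ~ conn true x y) ->
  exists2 h, proper h & forall x, B x -> h x.
Proof.
move=> B_even.
pose least x := forall k y, conn k x y -> ~~ B y && (x <= y).
pose B' x := B x \/ least x.
have B'_even x y : B' x -> B' y -> ~ conn true x y.
  move=> [Bx|lx] [By|ly] xy; first exact: B_even xy.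
  - by have := ly _ _ (conn_sym xy); rewrite Bx.
  - by have := lx _ _ xy; rewrite By.
  have /andP[_ yx] := ly _ _ (conn_sym xy); have /andP[_ xley] := lx _ _ xy.
  by apply: (@no_odd x); rewrite [X in conn _ _ X](_ : x = y) //; apply/eqP;
    rewrite eqn_leq xley.
have B'_conn x : exists k y, B' y /\ conn k x y.
  have [[k [y [By xy]]]|noB] := pselect (exists k y, B y /\ conn k x y).
    by exists k, y; split=> //; left.
  have exm : exists m, `[< exists k, conn k x m >].
    by exists x; apply/asboolP; exists false; apply: conn_refl.
  case: (ex_minnP exm) => m /asboolP[k xm] m_min; exists k, m; split=> //.
  right=> l y my; have xy := conn_trans xm my; apply/andP; split.
    by apply/negP => By; apply: noB; exists (k (+) l), y.
  by apply: m_min; apply/asboolP; exists (k (+) l).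
pose h x := `[< exists2 b, B' b & conn false x b >].
have hE k x y : B' y -> conn k x y -> h x = ~~ k.
  move=> By; case: k => xy; last by apply/asboolP; exists y.
  apply/asboolPn => -[b Bb xb].
  exact: (B'_even _ _ Bb By (conn_trans (conn_sym xb) xy)).
exists h => [x y xy|x Bx].
  have [k [b [Bb yb]]] := B'_conn y.
  by rewrite (hE _ _ _ Bb yb) (hE _ _ _ Bb (conn_trans (conn_edge xy) yb))
    negbK; case: k {yb}.
by rewrite (hE false x x) //; [left|apply: conn_refl].
Qed.

(** The first three edges of an odd walk are replaced by one edge with the same start, until a
    single edge remains. *)
Lemma conn_alpha (A : pred nat) :
    (forall x x2 x3 x4, A x -> E x x2 -> E x2 x3 -> E x3 x4 -> E x x4) ->
  forall x y, A x -> conn true x y -> E x y.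
Proof.
move=> Aalpha x y Ax [p []]; have [n] := ubnP (size p).
elim: n p => // n IHn [|x2 [|x3 [|x4 p]]] //=; first by rewrite andbT => _ ? <-.
move=> pn /and4P[x12 x23 x34 x4p] py podd; apply: (IHn (x4 :: p)) => //=;
  last by rewrite negbK in podd.
- exact: ltnW.
- by rewrite x4p andbT; exact: Aalpha x12 x23 x34.
Qed.

(** Membership in [A] travels along the walk two edges at a time. *)
Lemma conn_eta (A : pred nat) :
    (forall x y z, A x -> E x y -> E y z -> A z) ->
  forall x y, A x -> conn false x y -> A y.
Proof.
move=> Aeta x y Ax [p []]; have [n] := ubnP (size p).
elim: n x Ax p => // n IHn x Ax [|x2 [|x3 p]] //=; first by move=> _ _ <-.
move=> pn /and3P[x12 x23 x3p] py podd; apply: (IHn x3 _ p) => //=.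
- exact: Aeta x12 x23.
- exact: ltnW.
- by rewrite negbK in podd.
Qed.

(** * Separating assignments *)

Variable L : pred nat.
Variables i j : nat.

Definition compatible (f : nat -> M) : Prop :=
  (forall x, L x -> Mle i j (f x) Mc) /\
  (forall x y, E x y -> Mmul (f x) (f y) = Mc).

Definition separated : Prop :=
  (forall x, ~~ L x -> exists2 f, compatible f & ~~ Mle i j (f x) Mc) /\
  (forall x y, ~~ E x y -> exists2 f, compatible f & Mmul (f x) (f y) = M0).

Definition active (x : nat) : Prop := exists y, E x y.

Definition colM (hx ux : bool) : M :=
  if hx then if ux then Mq else Mb else if ux then Mp else Ma.

(** [U] holds the vertices valued [Mp] or [Mq]. It must be independent because these two are the
    only elements of opposite sides with product [M0]. *)
Record admissible (h U : pred nat) : Prop := Admissible {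
  adm_proper : proper h;
  adm_indep : forall x y, U x -> U y -> ~~ E x y;
  adm_mark : forall x, active x -> L x -> Mle i j (colM (h x) (U x)) Mc }.

(** Isolated vertices get [Mc] or [M0], all of whose products are [M0], so non-edges at them are
    separated at once. *)
Definition assign (h U : pred nat) (x : nat) : M :=
  if `[< active x >] then colM (h x) (U x) else if L x then Mc else M0.

Lemma compatible_assign h U : admissible h U -> compatible (assign h U).
Proof.
move=> [hP Uind hU]; split=> [x Lx|x y xy]; rewrite /assign.
  by rewrite Lx; case: asboolP => [/hU->//|_]; rewrite Mle_refl.
have ax : active x by exists y.
have ay : active y by exists x; rewrite E_sym.
rewrite !asboolT //; have := hP _ _ xy; have := Uind x y.
rewrite xy; case: (h x); case: (h y) => // + _; case: (U x);
  case: (U y) => // Uxy.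
all: by have := Uxy isT isT.
Qed.

Lemma separated_active :
    (exists h U, admissible h U) ->
    (forall x, active x -> ~~ L x ->
       exists h U, admissible h U /\ ~~ Mle i j (colM (h x) (U x)) Mc) ->
    (forall x y, active x -> active y -> ~~ E x y ->
       exists h U, admissible h U /\
         Mmul (colM (h x) (U x)) (colM (h y) (U y)) = M0) ->
  separated.
Proof.
move=> [h0 [U0 /compatible_assign adm0]] sepL sepE; split=> [x Lx|x y xy].
  have [ax|nax] := pselect (active x).
    have [h [U [/compatible_assign adm hx]]] := sepL x ax Lx.
    by exists (assign h U); rewrite // /assign asboolT.
  by exists (assign h0 U0); rewrite // /assign asboolF // (negbTE Lx) MleE.
have [ax|nax] := pselect (active x); last first.
  exists (assign h0 U0) => //; rewrite /assign (asboolF nax); case: (L x) => //.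
have [ay|nay] := pselect (active y); last first.
  exists (assign h0 U0) => //; rewrite MmulC /assign (asboolF nay);
    case: (L y) => //.
have [h [U [/compatible_assign adm hxy]]] := sepE x y ax ay xy.
by exists (assign h U); rewrite // /assign !asboolT.
Qed.

End Graph.

(** * Colourings and independent sets for each of the four semirings *)

Section Separation.

Variables (E : rel nat) (L : pred nat).
Hypothesis E_sym : symmetric E.
Hypothesis no_odd : forall x, ~ conn E true x x.

Let indep1 x y z : pred1 x y -> pred1 x z -> ~~ E y z.
Proof. by move=> /eqP-> /eqP->; apply: irr_E. Qed.

Let indep2 x y z t : ~~ E x y -> pred2 x y z -> pred2 x y t -> ~~ E z t.
Proof.
by move=> xy /orP[]/eqP-> /orP[]/eqP->; rewrite ?(irr_E no_odd) // E_sym.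
Qed.

Let B1_even x y z : pred1 x y -> pred1 x z -> ~ conn E true y z.
Proof. by move=> /eqP-> /eqP->; apply: no_odd. Qed.

Let B2_even x y z t : ~ conn E true x y ->
  pred2 x y z -> pred2 x y t -> ~ conn E true z t.
Proof.
move=> xy /orP[]/eqP-> /orP[]/eqP->; [exact: no_odd|exact: xy| |exact: no_odd].
by move/(conn_sym E_sym).
Qed.

(** Neither [Mp] nor [Mq] is below [Mc], so [U] has to avoid the active marked vertices; the
    colouring is free. *)
Lemma separated11 :
    (forall x x2 x3 x4, L x -> E x x2 -> E x2 x3 -> E x3 x4 -> E x x4) ->
  separated E L 1 1.
Proof.
move=> Lalpha.
have [h hP _] := @ex_coloring _ E_sym no_odd pred0 (fun _ _ _ => ltac:(done)).
apply: separated_active => // [|x _ Lx|x y _ _ xy].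
- by exists h, pred0; split=> // x _ _; rewrite MleE; case: (h x).
- exists h, (pred1 x); split; last by rewrite MleE /= eqxx; case: (h x).
  split=> // [|y _ Ly]; first exact: indep1.
  have /= -> : (y == x) = false by apply: contraNF Lx => /eqP<-.
  by rewrite MleE; case: (h y).
(* With a marked end, an odd walk would yield the edge [x y], so both ends can share a colour. With
   both unmarked, they can be put into [U]. *)
have [Lxy|] := boolP (L x || L y).
  have nxy : ~ conn E true x y.
    move=> cxy; case/negP: xy; case/orP: Lxy => ?.
      exact: (conn_alpha Lalpha) cxy.
    by rewrite E_sym; apply: (conn_alpha Lalpha) => //; apply: conn_sym.
  have [g gP gB] := ex_coloring E_sym no_odd (fun z t => @B2_even x y z t nxy).
  exists g, pred0; split; last by rewrite !gB //= eqxx ?orbT.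
  by split=> // z _ _; rewrite MleE; case: (g z).
rewrite negb_or => /andP[Lx Ly].
exists h, (pred2 x y); split; last by rewrite /= !eqxx orbT; case: (h x);
  case: (h y).
split=> // [z t|z _ Lz]; first exact: indep2.
have /= -> : pred2 x y z = false.
  by apply/negP => /orP[]/eqP zE; rewrite -zE Lz in Lx Ly.
by rewrite MleE; case: (h z).
Qed.

(** Only [Mp] and [M0] are not below [Mc], so marked vertices of [U] must be coloured [true]. *)
Lemma separated12 :
    (forall x y, L x -> L y -> conn E true x y -> E x y) ->
  separated E L 1 2.
Proof.
move=> Ltheta.
have [h0 h0P _] := @ex_coloring _ E_sym no_odd pred0 (fun _ _ _ => ltac:(done)).
have adm h (U : pred nat) : proper E h -> (forall x y, U x -> U y ->
  ~~ E x y) ->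
    (forall x, L x -> U x -> h x) -> admissible E L 1 2 h U.
  move=> hP Uind hU; split=> // x _ /hU; rewrite MleE.
  by case: (h x); case: (U x) => //= /(_ isT).
have sep2 x y : ~~ L x -> ~~ E x y -> exists h U, admissible E L 1 2 h U /\
    Mmul (colM (h x) (U x)) (colM (h y) (U y)) = M0.
  move=> Lx xy; have [h hP /(_ y (eqxx _)) hy] :=
    ex_coloring E_sym no_odd (@B1_even y).
  (* Either the colours differ and [x], [y] become [Mp], [Mq], or they agree and the product
     vanishes anyway. *)
  have [hx|hx] := boolP (h x); last first.
    exists h, (pred2 x y); split; last by rewrite hy (negbTE hx) /= !eqxx orbT.
    apply: adm => // [z t|z Lz /orP[]/eqP zE]; first exact: indep2.
      by rewrite -zE Lz in Lx.
    by rewrite zE.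
  by exists h, pred0; split; [apply: adm|rewrite hx hy].
apply: separated_active => // [|x [y xy] Lx|x y _ _ xy].
- by exists h0, pred0; apply: adm.
(* Colouring a neighbour [true] forces [x] to [false], so that [x] can take the value [Mp]. *)
- have [h hP /(_ y (eqxx _)) hy] := ex_coloring E_sym no_odd (@B1_even y).
  have hx : h x = false by have := hP _ _ xy; rewrite hy addbT => /negbTE.
  exists h, (pred1 x); split; last by rewrite MleE hx /= eqxx.
  apply: adm => // [|z Lz /eqP zE]; first exact: indep1.
  by rewrite -zE Lz in Lx.
have [Lx|Lx] := boolP (L x); last exact: sep2.
have [Ly|/sep2] := boolP (L y); last first.
  move=> /(_ x); rewrite E_sym => /(_ xy) [h [U [hU]]].
  by exists h, U; rewrite MmulC.
have nxy : ~ conn E true x y by move=> /(Ltheta _ _ Lx Ly); apply/negP.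
have [g gP gB] := ex_coloring E_sym no_odd (fun z t => @B2_even x y z t nxy).
exists g, pred0; split; last by rewrite !gB //= eqxx ?orbT.
exact: adm.
Qed.

Hypothesis Lxi : forall x y, L x -> L y -> ~~ E x y.

(** Active marked vertices must take the value [Mb]: coloured [true] and outside [U]. Such a
    colouring exists since an odd walk between marks would become an edge, against [Lxi]. *)
Lemma separated01 :
    (forall x x2 x3 x4, L x -> E x x2 -> E x2 x3 -> E x3 x4 -> E x x4) ->
    (forall x y z t, L x -> E x y -> L t -> E t z -> E x z) ->
  separated E L 0 1.
Proof.
move=> Lalpha Lbeta.
have L_even x y : L x -> L y -> ~ conn E true x y.
  by move=> Lx Ly /(conn_alpha Lalpha Lx); apply/negP/Lxi.
have [h hP hL] := ex_coloring E_sym no_odd L_even.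
have adm g (U : pred nat) : proper E g -> (forall x, L x -> g x) ->
    (forall x y, U x -> U y -> ~~ E x y) -> (forall x, U x -> ~~ L x) ->
    admissible E L 0 1 g U.
  move=> gP gL Uind UL; split=> // x _ Lx; rewrite MleE gL //.
  by have := UL x; rewrite Lx; case: (U x) => // /(_ isT).
have sep2 x y : active E x -> ~~ E x y -> h x -> ~~ h y ->
    exists h U, admissible E L 0 1 h U /\
      Mmul (colM (h x) (U x)) (colM (h y) (U y)) = M0.
  move=> [x' xx'] xy hx hy; have Ly : ~~ L y by apply: contra (hL y) hy.
  have [Lx|Lx] := boolP (L x); last first.
    exists h, (pred2 x y); split; last by rewrite hx (negbTE hy) /= !eqxx orbT.
    by apply: adm => // [z t|z /orP[]/eqP->//]; first exact: indep2.
  (* An odd walk from a mark to [y] shortens to an edge, and [Lbeta] then gives the edge [x y]. So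
     [y] can be coloured like the marks. *)
  have Ly_even m : L m -> ~ conn E true m y.
    move=> Lm /(conn_alpha Lalpha Lm) my; case/negP: xy.
    exact: Lbeta Lx xx' Lm my.
  have B_even z t : predU1 y L z -> predU1 y L t -> ~ conn E true z t.
    move=> /predU1P[->|Lz] /predU1P[->|Lt];
      [exact: no_odd| |exact: Ly_even|exact: L_even].
    by move=> /(conn_sym E_sym); apply: Ly_even.
  have [g gP gB] := ex_coloring E_sym no_odd B_even.
  exists g, pred0; split; last by rewrite !gB //= ?eqxx ?Lx ?orbT.
  by apply: adm => // z Lz; apply: gB; rewrite /= Lz orbT.
apply: separated_active => // [|x _ Lx|x y ax ay xy].
- by exists h, pred0; apply: adm.
- exists h, (pred1 x); split; last by rewrite MleE /= eqxx; case: (h x).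
  by apply: adm => // [|z /eqP->//]; exact: indep1.
have [hx|hx] := boolP (h x); have [hy|hy] := boolP (h y).
- by exists h, pred0; split; [apply: adm|rewrite hx hy].
- exact: sep2.
- have [|g [U [gU]]] := sep2 y x ay _ hy hx; first by rewrite E_sym.
  by exists g, U; rewrite MmulC.
- by exists h, pred0; split; [apply: adm|rewrite (negbTE hx) (negbTE hy)].
Qed.

(** Marked vertices must be coloured [true], but may lie in [U], as both [Mb] and [Mq] are below
    [Mc]. *)
Lemma separated02 :
    (forall x y z, L x -> E x y -> E y z -> L z) ->
  separated E L 0 2.
Proof.
move=> Leta.
have L_even x y : L x -> L y -> ~ conn E true x y.
  move=> Lx Ly /conn_true_split[z xz /(conn_sym E_sym) yz].
  by case/negP: (Lxi Lx (conn_eta Leta Ly yz)).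
have [h hP hL] := ex_coloring E_sym no_odd L_even.
have adm g (U : pred nat) : proper E g -> (forall x, L x -> g x) ->
    (forall x y, U x -> U y -> ~~ E x y) -> admissible E L 0 2 g U.
  by move=> gP gL Uind; split=> // x _ Lx; rewrite MleE gL //; case: (U x).
apply: separated_active => // [|x [y xy] Lx|x y ax ay xy].
- by exists h, pred0; apply: adm.
(* An odd walk from [y] to a mark extends to an even walk from the mark to [x], which would mark
   [x]. So [y] can be coloured like the marks, which puts [x] on the side {a, p}. *)
- have Ly_even m : L m -> ~ conn E true y m.
    move=> Lm ym; case/negP: Lx; apply: (conn_eta Leta Lm).
    exact: (conn_sym E_sym (conn_trans (conn_edge xy) ym)).
  have B_even z t : predU1 y L z -> predU1 y L t -> ~ conn E true z t.
    move=> /predU1P[->|Lz] /predU1P[->|Lt];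
      [exact: no_odd|exact: Ly_even| |exact: L_even].
    by move=> /(conn_sym E_sym); apply: Ly_even.
  have [g gP gB] := ex_coloring E_sym no_odd B_even.
  have gy : g y by apply: gB; rewrite /= eqxx.
  have gx : g x = false by have := gP _ _ xy; rewrite gy addbT => /negbTE.
  exists g, (pred1 x); split; last by rewrite MleE gx /= eqxx.
  apply: adm => // [z Lz|]; last exact: indep1.
  by apply: gB; rewrite /= Lz orbT.
have [hxy|hxy] := eqVneq (h x) (h y).
  by exists h, pred0; split; [apply: adm|rewrite hxy; case: (h y)].
exists h, (pred2 x y); split; last by rewrite /= !eqxx orbT; case: (h x);
  case: (h y).
by apply: adm => // z t; apply: indep2.
Qed.

End Separation.

(** * Completeness *)

Section Model.

Variables (S : caiSemiring) (g : nat -> S) (s : S).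

Definition edge : rel nat := fun x y => `[< sle (smul (g x) (g y)) s >].
Definition mark : pred nat := fun x => `[< sle (g x) s >].

Lemma edge_sym : symmetric edge.
Proof. by move=> x y; rewrite /edge smulC. Qed.

Lemma mark_alpha : satisfies S alpha ->
  forall x x2 x3 x4, mark x -> edge x x2 -> edge x2 x3 -> edge x3 x4 ->
    edge x x4.
Proof.
move=> Salpha x x2 x3 x4 /asboolP Lx /asboolP x12 /asboolP x23 /asboolP x34.
(* [alpha] numbers its variables from 1, so slot 0 is a filler. *)
apply/asboolP; apply: (sle_of_sat (f := g \o nth 0 [:: 0; x; x2; x3;
  x4]) Salpha).
by rewrite /= !sle_add.
Qed.

Lemma mark_beta : satisfies S beta ->
  forall x y z t, mark x -> edge x y -> mark t -> edge t z -> edge x z.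
Proof.
move=> Sbeta x y z t /asboolP Lx /asboolP xy /asboolP Lt /asboolP tz.
apply/asboolP; apply: (sle_of_sat (f := g \o nth 0 [:: x; y; z; t]) Sbeta).
by rewrite /= !sle_add.
Qed.

Lemma mark_eta : satisfies S eta ->
  forall x y z, mark x -> edge x y -> edge y z -> mark z.
Proof.
move=> Seta x y z /asboolP Lx /asboolP xy /asboolP yz.
apply/asboolP; apply: (sle_of_sat (f := g \o nth 0 [:: x; y; z]) Seta).
by rewrite /= !sle_add.
Qed.

Lemma path_nth x p k : path edge x p -> k < size p ->
  sle (smul (g (nth x (x :: p) k)) (g (nth x (x :: p) k.+1))) s.
Proof. by move=> /(pathP x) xp /xp/asboolP. Qed.

Lemma mark_theta : (forall n, 0 < n -> satisfies S (theta n)) ->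
  forall x y, mark x -> mark y -> conn edge true x y -> edge x y.
Proof.
move=> Stheta x y /asboolP Lx /asboolP Ly [p [xp py podd]].
have pE : size p = (2 * (size p)./2).+1 by rewrite mul2n -[LHS]odd_double_half
  podd.
(* The family [theta] starts at 1; a walk of length one is already the edge. *)
case: (posnP (size p)./2) => [p0|/Stheta Sp].
  rewrite p0 in pE; case: p pE xp py {podd p0} => [|z [|//]] //= _.
  by rewrite andbT => xz <-.
have nl : nth x p (2 * (size p)./2) = y.
  by rewrite -py (last_nth x) [in RHS]pE.
apply/asboolP; rewrite -nl.
apply: (sle_of_sat (f := fun k => g (nth x (x :: p) k.-1)) Sp).
rewrite tsum_cons sle_tsum; split=> [|[|k]]; first by rewrite /= nl sle_add.
  by rewrite mem_index_iota.
rewrite mem_index_iota ltnS -pE => /path_nth; exact.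
Qed.

Hypothesis S_Sigma0 : models S Sigma0.
Variable x0 : S.
Hypothesis x0s : ~ sle x0 s.

Lemma square_not_le (y : S) : ~ sle (smul y y) s.
Proof.
move=> ys; apply: x0s; apply: sle_trans ys.
have S1 : satisfies S ('x_0 ⪯ 'x_1 * 'x_1) by apply: S_Sigma0; left; left.
exact: (S1 (nth x0 [:: x0; y])).
Qed.

Lemma product3_not_le (x y z : S) : ~ sle (smul (smul x y) z) s.
Proof.
have S2 : satisfies S ('x_0 * 'x_0 ≈ 'x_1 * 'x_2 * 'x_3).
  by apply: S_Sigma0; left; right.
have /= <- := S2 (nth x0 [:: x0; x; y; z]).
exact: square_not_le.
Qed.

Lemma edge_irr x : ~~ edge x x.
Proof. by apply/asboolPn; apply: square_not_le. Qed.

(** A closed walk of length [2n+1] puts the right side of [sigma n], hence [x0], below [s]; a loop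
    would put a square there. *)
Lemma edge_no_odd x : ~ conn edge true x x.
Proof.
move=> [p [xp px podd]].
have pE : size p = (2 * (size p)./2).+1 by rewrite mul2n -[LHS]odd_double_half
  podd.
case: (posnP (size p)./2) => [p0|p0].
  rewrite p0 in pE; case: p pE xp px {podd p0} => [|z [|//]] //= _.
  by rewrite andbT => xz zx; move: (edge_irr x); rewrite -{2}zx xz.
have Ss : satisfies S (sigma (size p)./2) by apply: S_Sigma0; right;
  exists (size p)./2.
apply: x0s.
pose f k := if k is k'.+1 then g (nth x (x :: p) k') else x0.
apply: (sle_of_sat (f := f) Ss);
  rewrite tsum_rcons [eval _ (Add _ _)]/= sle_add sle_tsum.
split; first split.
- by apply: (path_nth xp (k := 0)); rewrite pE.
- case=> [|k]; rewrite mem_index_iota // ltnS => /andP[_ kp].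
  by apply: (path_nth xp); rewrite pE ltnW.
- have := @path_nth x p (2 * (size p)./2) xp; rewrite {2}pE ltnSn => /(_ isT).
  by rewrite -pE -(last_nth x) px.
Qed.

Lemma mark_xi : satisfies S xi -> forall x y, mark x -> mark y -> ~~ edge x y.
Proof.
move=> Sxi x y /asboolP Lx /asboolP Ly; apply/asboolPn => xy.
apply: (@square_not_le (g x)); have /= -> := Sxi (g \o nth 0 [:: x; y]).
by rewrite !sle_add.
Qed.

(** A compatible assignment sends every word of [v] below [Mc], hence by the identity every word of
    [u]. Separation rules this out for a word not below [s]. *)
Lemma sle_of_separated i j u v :
    separated edge mark i j -> satisfies (R i j) (u, v) -> sle (eval g v) s ->
  sle (eval g u) s.
Proof.
move=> [sepL sepE] uv /sle_words vs; apply/sle_words => w uw.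
have w_le f : compatible edge mark i j f -> Mle i j (eval (f : nat ->
  R i j) w) Mc.
  move=> [fL fE]; apply/sle_Mle.
  move: w uw; apply/sle_words; have /= -> := uv f.
  apply/sle_words => w vw; have /= ws := vs _ vw; apply/sle_Mle.
  case: (wordP vw) => [x wE|x y wE|a b c wE]; rewrite wE /= in ws *.
  - by apply: fL; apply/asboolP.
  - by rewrite fE ?Mle_refl //; apply/asboolP.
  - by case: (product3_not_le ws).
apply: contrapT => nws; case: (wordP uw) => [x wE|x y wE|a b c wE].
- have [|f /w_le fw /negP[]] := sepL x; last by rewrite wE in fw.
  by apply/asboolPn; rewrite wE in nws.
- have [|f /w_le fw fxy] := sepE x y; last by rewrite wE /= fxy MleE in fw.
  by apply/asboolPn; rewrite wE in nws.
(* A word of at least three letters is always [M0], so any compatible assignment works; the non-edge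
   [0 0] supplies one. *)
- have [f /w_le fw _] := sepE 0 0 (edge_irr 0).
  by rewrite wE /= MleE in fw; move: fw; case: (eval _ a); case: (eval _ b);
    case: (eval _ c).
Qed.

End Model.

Lemma basis_of_separated i j (T : set identity) :
    models (R i j) T ->
    (forall (S : caiSemiring) (g : nat -> S) s x0,
       models S Sigma0 -> models S T -> ~ sle x0 s ->
       separated (edge g s) (mark g s) i j) ->
  is_basis (R i j) (Sigma0 `|` T)%classic.
Proof.
move=> RT sepT; split=> [e [/sound_Sigma0//|/RT//]|[u v] uv S SST g].
have S0 : models S Sigma0 by move=> e ?; apply: SST; left.
have ST : models S T by move=> e ?; apply: SST; right.
have le a b : satisfies (R i j) (a, b) -> sle (eval g a) (eval g b).
  (* If the inequality fails, the left value itself is the [x0] showing that [s], the right value,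
     is not the top. *)
  move=> ab; apply: contrapT => nab.
  apply: (nab); apply: (sle_of_separated S0 nab _ ab); last exact: sle_refl.
  exact: sepT S0 ST nab.
by apply: sle_anti; apply: le => // f; rewrite uv.
Qed.

Local Open Scope classical_set_scope.

Theorem theorem4p1 :
  [/\ is_basis (R 0 1) (Sigma0 `|` [set xi; alpha; beta]),
      is_basis (R 0 2) (Sigma0 `|` [set xi; eta]),
      is_basis (R 1 1) (Sigma0 `|` [set alpha]) &
      is_basis (R 1 2) (Sigma0 `|` [set theta n | n in [set n | (1 <= n)%N]])].
Proof.
split; apply: basis_of_separated.
- by move=> e [[->|->]|->]; [exact: sat_xi|exact: sat_alpha|exact: sat_beta].
- move=> S g s x0 S0 ST x0s; have no_odd := edge_no_odd S0 x0s.
  apply: separated01 => //; first exact: edge_sym.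
  + by apply: (mark_xi S0 x0s); apply: ST; left; left.
  + by apply: mark_alpha; apply: ST; left; right.
  + by apply: mark_beta; apply: ST; right.
- by move=> e [->|->]; [exact: sat_xi|exact: sat_eta].
- move=> S g s x0 S0 ST x0s; have no_odd := edge_no_odd S0 x0s.
  apply: separated02 => //; first exact: edge_sym.
  + by apply: (mark_xi S0 x0s); apply: ST; left.
  + by apply: mark_eta; apply: ST; right.
- by move=> e ->; apply: sat_alpha.
- move=> S g s x0 S0 ST x0s; have no_odd := edge_no_odd S0 x0s.
  by apply: separated11 => //; [exact: edge_sym|apply: mark_alpha; apply: ST].
- by move=> e [n _ <-]; apply: sat_theta.
- move=> S g s x0 S0 ST x0s; have no_odd := edge_no_odd S0 x0s.
  apply: separated12 => //; first exact: edge_sym.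
  by apply: mark_theta => n n0; apply: ST; exists n.
Qed.
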